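(* For real $x$ set $(x)_{+}=\max(0,x)$. Let $m_1,m_2\in\mathbb{Z}$ with $m_1^2+m_2^2>0$, and let $\alpha,\gamma$ be complex parameters for which all expressions below are well defined (in the sense specified in the context). Then for all complex $t$ $$ \frac{(1-\alpha)_{m_1}\,t^{(m_2)_{+}}}{(2-\gamma)_{m_2}}\; {}_{1}F_{1}(\alpha;\gamma;t)\; {}_{1}F_{1}(1-\alpha+m_1;\,2-\gamma+m_2;\,-t) $$ $$ -\,(1-\gamma)_{m_2}(\gamma-\alpha)_{m_1-m_2}\,t^{(-m_2)_{+}}\; {}_{1}F_{1}(1-\alpha;\,2-\gamma;\,-t)\; {}_{1}F_{1}(\alpha-m_1;\,\gamma-m_2;\,t) =P_{r}(t), $$ where $P_r(t)$ is a polynomial in $t$ of degree $r\le\max(|m_1|,|m_2-m_1|)-1$. This polynomial is the truncation of the Taylor expansion in $t$ (at $t=0$) of the left-hand side to the powers $t^n$ with $0\le n\le\max(|m_1|,|m_2-m_1|)-1$; equivalently, the coefficient of $t^n$ in the left-hand side vanishes for every $n\ge\max(|m_1|,|m_2-m_1|)$.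
   Context: The Kummer function is ${}_1F_1(a;b;x)=\sum_{k\ge0}\frac{(a)_k}{(b)_k}\frac{x^k}{k!}$. The Pochhammer symbol is $(z)_k=\Gamma(z+k)/\Gamma(z)$ for all integers $k$: for $k\ge0$ it is $z(z+1)\cdots(z+k-1)$ (with $(z)_0=1$), and for $k<0$ it is $(z)_k=(-1)^k/(1-z)_{-k}$. ''Well defined'' means: none of the lower parameters $\gamma$, $2-\gamma$, $2-\gamma+m_2$, $\gamma-m_2$ is a non-positive integer, all Pochhammer symbols in the prefactors are finite, and $(2-\gamma)_{m_2}\ne0$. *)

(* Defs.v *)
From HB Require Import structures.
From mathcomp Require Import all_boot all_order all_algebra.
From mathcomp Require Import all_classical all_reals all_analysis.
From mathcomp Require Import complex.

Set Implicit Arguments.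
Unset Strict Implicit.
Unset Printing Implicit Defensive.

Import Order.TTheory GRing.Theory Num.Theory.
Import numFieldNormedType.Exports.

Local Open Scope classical_set_scope.
Local Open Scope ring_scope.

(* The analytic definitions take an arbitrary [K : numFieldType], because it is
   such a carrier (and not the bare type [R[i]]) that carries the norm
   topology; they are meant for the complex field [R[i]], [R : realType]. *)

Definition pochn (K : numFieldType) (z : K) (k : nat) : K :=
  \prod_(i < k) (z + i%:R).

(* [Negz j] is the integer -(j + 1). *)
Definition pochz (K : numFieldType) (z : K) (k : int) : K :=
  match k with
  | Posz j => pochn z j
  | Negz j => (-1) ^+ j.+1 / pochn (1 - z) j.+1
  end.

(* Division by zero is 0 in the library, so that the poles of [pochz z k]
   in [z] have to be excluded explicitly. *)
Definition pochz_finite (K : numFieldType) (z : K) (k : int) : Prop :=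
  match k with
  | Posz _ => True
  | Negz j => pochn (1 - z) j.+1 != 0
  end.

Definition not_nonpos_int (K : numFieldType) (z : K) : Prop :=
  forall n : nat, z != - n%:R.

Definition hyp1F1 (K : numFieldType) (a b x : K) : K :=
  limn (series (fun k : nat => pochn a k / pochn b k * (x ^+ k / k`!%:R))).

Definition taylor_coef (K : numFieldType) (f : K -> K) (n : nat) : K :=
  derive1n n f 0 / n`!%:R.

Definition pos_part (D : realDomainType) (x : D) : D := Num.max 0 x.

Definition well_defined (K : numFieldType) (m1 m2 : int) (alpha gamma : K)
    : Prop :=
  [/\ [/\ not_nonpos_int gamma,
          not_nonpos_int (2 - gamma),
          not_nonpos_int (2 - gamma + m2%:~R) &
          not_nonpos_int (gamma - m2%:~R)],
      [/\ pochz_finite (1 - alpha) m1,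
          pochz_finite (2 - gamma) m2,
          pochz_finite (1 - gamma) m2 &
          pochz_finite (gamma - alpha) (m1 - m2)] &
      pochz (2 - gamma) m2 != 0].

Definition kummer_lhs (K : numFieldType) (m1 m2 : int) (alpha gamma t : K)
    : K :=
  pochz (1 - alpha) m1 * t ^ pos_part m2 / pochz (2 - gamma) m2
    * hyp1F1 alpha gamma t
    * hyp1F1 (1 - alpha + m1%:~R) (2 - gamma + m2%:~R) (- t)
  - pochz (1 - gamma) m2 * pochz (gamma - alpha) (m1 - m2) * t ^ pos_part (- m2)
    * hyp1F1 (1 - alpha) (2 - gamma) (- t)
    * hyp1F1 (alpha - m1%:~R) (gamma - m2%:~R) t.

(* Main.v *)
(* Put m = m2, M = m1 - m + n, c = gamma and a = alpha. For c not an integer,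
   Kummer's transformation 1F1(a;c;t) = e^t 1F1(c-a;c;-t), applied to both
   factors, turns the second product into a product with the same shape as the
   first one, for the parameters (m1 - m2, -m2, 1 - c + a, 2 - c). One may thus
   assume m >= 0. The coefficient of t^n on either side is then, up to a common
   factor, the sum of the residues of the rational function
     (z + a - M)_M /
       (prod_(0 <= k <= n - m) (z - k) prod_(0 <= j <= n) (z - 1 + c - j))
   at the nodes k, resp. at the nodes 1 - c + j. For n >= max(|m1|, |m2 - m1|)
   its numerator is a polynomial of degree at most the degree of the denominator
   minus two, so that the residues cancel. If n < m, the first product in the
   denominator becomes the factor (z + 1)_(m-n-1) of the numerator. An integer c is only possible
   for c = 1 and m2 = 0, in which case the two products coincide by Kummer's
   transformation. *)
Require Import Defs.
From HB Require Import structures.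
From mathcomp Require Import all_boot all_order all_algebra.
From mathcomp Require Import all_classical all_reals all_analysis.
From mathcomp Require Import complex.
From mathcomp Require Import ring lra zify.
Import Order.TTheory GRing.Theory Num.Theory.
Import numFieldNormedType.Exports.
Local Open Scope ring_scope.

Section Kummer.
Local Open Scope classical_set_scope.
Variable K : numFieldType.
Implicit Types (a b c t z : K) (u v : nat -> K).

(** * Pochhammer symbols with natural and integer index *)

Lemma pochn0 z : pochn z 0 = 1.
Proof. by rewrite /pochn big_ord0. Qed.

Lemma pochnS z k : pochn z k.+1 = pochn z k * (z + k%:R).
Proof. by rewrite /pochn big_ord_recr. Qed.

Lemma pochnD z j k : pochn z (j + k) = pochn z j * pochn (z + j%:R) k.
Proof.
elim: k => [|k IH]; first by rewrite addn0 pochn0 mulr1.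
by rewrite addnS !pochnS IH natrD addrA mulrA.
Qed.

Lemma pochnSl z k : pochn z k.+1 = z * pochn (z + 1) k.
Proof. by rewrite -add1n pochnD pochnS pochn0 mul1r addr0. Qed.

Lemma pochn_refl z k : pochn z k = (-1) ^+ k * pochn (1 - z - k%:R) k.
Proof.
rewrite /pochn -{6}(card_ord k) -prodrN.
rewrite (reindex_inj rev_ord_inj) /=; apply: eq_bigr => i _.
have -> : (k - i.+1)%N%:R = k%:R - i%:R - 1 :> K.
  by rewrite natrB // -natr1 opprD addrA.
ring.
Qed.

Lemma pochn_neq0 z k : not_nonpos_int z -> pochn z k != 0.
Proof.
move=> hz; apply/prodf_neq0 => i _.
by apply: contra (hz i); rewrite addr_eq0.
Qed.

(** Two runs of consecutive factors start at [a] and [a + r - l] and stop before [a + k] and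
    [a + r]; they exchange their right ends. *)
Lemma pochn_swap a (r k l : nat) : (r <= k + l)%N ->
  pochn a k * pochn (a + r%:R - l%:R) l =
  pochn a r * pochn (a + r%:R - l%:R) (k + l - r).
Proof.
move=> h; case: (leqP l r) => hl.
  have -> : pochn a k = pochn a (r - l) * pochn (a + r%:R - l%:R) (k + l - r).
    have {1}-> : k = (r - l + (k + l - r))%N by lia.
    by rewrite pochnD natrB // addrA.
  have -> : pochn a r = pochn a (r - l) * pochn (a + r%:R - l%:R) l.
    have {1}-> : r = (r - l + l)%N by lia.
    by rewrite pochnD natrB // addrA.
  ring.
set b := a + r%:R - l%:R.
have ab : b + (l - r)%N%:R = a by rewrite natrB 1?ltnW // /b; ring.
have -> : pochn b l = pochn b (l - r) * pochn a r.
  have {1}-> : l = (l - r + r)%N by lia.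
  by rewrite pochnD ab.
have -> : pochn b (k + l - r) = pochn b (l - r) * pochn a k.
  have -> : (k + l - r = l - r + k)%N by lia.
  by rewrite pochnD ab.
ring.
Qed.

(* Reflecting the symbols at [1 - a] extends [(a)_k] downwards, to the factors
   a - M + k, ..., a - 1, a, ..., a + k - 1. *)
Lemma pochz_merge a (m : int) (k l M : nat) :
  pochz_finite (1 - a) m -> M%:Z = m + k%:Z + l%:Z ->
  pochn a k * pochz (1 - a) m * pochn (1 - a + m%:~R) l =
  (-1) ^+ (M + k) * pochn (a - M%:R + k%:R) M.
Proof.
case: m => r /= fin hM.
  have -> : M = (r + l + k)%N by lia.
  rewrite -mulrA -[X in pochn _ _ * X]pochnD [pochn (1 - a) _]pochn_refl.
  rewrite [in RHS]pochnD.
  have -> : a - (r + l + k)%N%:R + k%:R = 1 - (1 - a) - (r + l)%N%:R.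
    by rewrite !natrD; ring.
  have -> : 1 - (1 - a) - (r + l)%N%:R + (r + l)%N%:R = a by ring.
  have -> : (-1) ^+ (r + l + k + k) = (-1) ^+ (r + l) :> K.
    rewrite -signr_odd -[RHS]signr_odd; congr (_ ^+ _); congr nat_of_bool; lia.
  ring.
(* Here [m = -(r + 1)], and [pochz] divides by [(a)_(r+1)]. Since [M] is a natural number,
   [pochn_swap] applies and brings out this factor. *)
have h : (r.+1 <= k + l)%N by lia.
have -> : M = (k + l - r.+1)%N by lia.
have -> : a - (k + l - r.+1)%N%:R + k%:R = a + r.+1%:R - l%:R.
  by rewrite natrB // natrD; ring.
have e1 : 1 - (1 - a) = a by ring.
rewrite e1 in fin *.
rewrite NegzE mulrNz [pochn (1 - a - _) l]pochn_refl.
have -> : 1 - (1 - a - r.+1%:~R) - l%:R = a + r.+1%:R - l%:R by ring.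
have -> : (-1) ^+ (k + l - r.+1 + k) = (-1) ^+ (r.+1 + l) :> K.
  rewrite -signr_odd -[RHS]signr_odd; congr (_ ^+ _); congr nat_of_bool; lia.
rewrite exprD.
set s1 := _ ^+ r.+1; set s2 := _ ^+ l.
apply: (mulfI fin).
have -> : pochn a r.+1 * (s1 * s2 * pochn (a + r.+1%:R - l%:R) (k + l - r.+1)) =
  s1 * s2 * (pochn a k * pochn (a + r.+1%:R - l%:R) l).
  by rewrite (pochn_swap _ _ _ _ h); ring.
by move: (pochn a r.+1) fin => y y0; field.
Qed.

(** * Divided differences and residues *)

(* The left-hand side is the coefficient of X^(d-1) in the Lagrange interpolant
   of [p], which is [p] itself. *)
Lemma divided_difference_eq0 (d : nat) (x : 'I_d -> K) (p : {poly K}) :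
  injective x -> (size p < d)%N ->
  \sum_i p.[x i] / \prod_(j | j != i) (x i - x j) = 0.
Proof.
move=> xI sp.
pose D i := \prod_(j | j != i) (x i - x j).
pose L i : {poly K} := \prod_(j | j != i) ('X - (x j)%:P).
have D0 i : D i != 0.
  by apply/prodf_neq0 => j ji; rewrite subr_eq0 (inj_eq xI) eq_sym.
have sL i : size (L i) = d.
  rewrite /L -big_filter size_prod_XsubC size_filter.
  have := count_predC (pred1 i) (index_enum 'I_d).
  rewrite -[X in _ = X -> _](size_map (fun i : 'I_d => i)).
  have -> : count (pred1 i) (index_enum 'I_d) = 1%N.
    by rewrite enumP.
  have -> : size [seq i | i <- index_enum 'I_d] = d.
    by rewrite map_id /index_enum -enumT size_enum_ord.
  by rewrite add1n.
have LM i : L i \is monic by apply: monic_prod => j _; exact: monicXsubC.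
pose S := \sum_i (p.[x i] / D i) *: L i.
have sS : (size S <= d)%N.
  apply: leq_trans (size_sum _ _ _) _; apply/bigmax_leqP => i _.
  apply: leq_trans (size_scale_leq _ _) _.
  by rewrite sL.
have SE j : S.[x j] = p.[x j].
  rewrite /S horner_sum (bigD1 j) //= [X in _ + X]big1 ?addr0.
    rewrite hornerZ /L horner_prod.
    under eq_bigr do rewrite hornerXsubC.
    by rewrite divfK.
  move=> i ij; rewrite hornerZ /L horner_prod (bigD1 j) 1?eq_sym //=.
  by rewrite hornerXsubC subrr mul0r mulr0.
have Sp : S = p.
  apply/eqP; rewrite -subr_eq0; apply/eqP.
  apply: (@roots_geq_poly_eq0 _ _ (map x (enum 'I_d))).
  - apply/allP => _ /mapP[j _ ->].
    by rewrite /root !hornerE SE subrr.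
  - by rewrite map_inj_uniq ?enum_uniq.
  - rewrite size_map size_enum_ord.
    by rewrite (leq_trans (size_polyD _ _)) // size_polyN geq_max sS ltnW.
have d0 : (0 < d)%N by apply: leq_trans sp.
transitivity (S`_d.-1); last by rewrite Sp nth_default // -ltnS prednK.
rewrite /S coef_sum; apply: eq_bigr => i _.
rewrite coefZ -/(D i).
by have /monicP := LM i; rewrite /lead_coef sL => ->; rewrite mulr1.
Qed.

Lemma prod_succ_fact k : \prod_(i < k) i.+1%:R = k`!%:R :> K.
Proof.
elim: k => [|k IH]; first by rewrite big_ord0.
by rewrite big_ord_recr /= IH factS natrM mulrC.
Qed.

(** The nodes below [k] contribute [k!], the [d] nodes above it [(-1)^d d!]. Writing the range as
    [k + d] allows induction on [d]. *)
Lemma prod_diff_nat (k d : nat) :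
  \prod_(j < (k + d).+1 | j != k :> nat) (k%:R - j%:R) =
  k`!%:R * ((-1) ^+ d * d`!%:R) :> K.
Proof.
elim: d => [|d IH].
  rewrite addn0 mulr1 mulr1 big_mkcond big_ord_recr /= eqxx mulr1.
  rewrite -prod_succ_fact (reindex_inj rev_ord_inj) /=; apply: eq_bigr => i _.
  have ik := ltn_ord i.
  rewrite ifT; last by lia.
  by rewrite -natrB; last lia; congr _%:R; lia.
rewrite addnS big_mkcond big_ord_recr /= -big_mkcond /= IH ifT; last by lia.
by rewrite factS exprS natrM -!natr1 natrD; ring.
Qed.

(** This case split removes signs with a variable exponent before [ring] or [field] is called. *)
Lemma signr_dec n : {(-1) ^+ n = 1 :> K} + {(-1) ^+ n = -1 :> K}.
Proof. by rewrite -signr_odd; case: odd; [right; rewrite expr1|left]. Qed.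

Definition kcoef (a b : K) (k : nat) : K := pochn a k / pochn b k / k`!%:R.

(** The right-hand side is a constant times the residue at the node [k]. [pochz_merge] collects the
    symbols in [a] into the numerator, and those in [c] into the factors of the nodes
    [1 - c + j]. *)
Lemma first_product_residue a c (m1 : int) (m n M k l : nat) :
  not_nonpos_int c -> not_nonpos_int (2 - c) ->  c != 1 ->
  pochz_finite (1 - a) m1 -> M%:Z = m1 - m%:Z + n%:Z ->
  (k + l + m = n)%N ->
  pochz (1 - a) m1 / pochn (2 - c) m *
    (kcoef a c k * ((-1) ^+ l * kcoef (1 - a + m1%:~R) (2 - c + m%:R) l)) =
  (-1) ^+ (M + n) * (c - 1) *
    (pochn (a - M%:R + k%:R) M /
     (k`!%:R * ((-1) ^+ l * l`!%:R) * pochn (c - 1 + k%:R - n%:R) n.+1)).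
Proof.
move=> c0 c2 c1 fin hM hn.
have hM' : M%:Z = m1 + k%:Z + l%:Z by lia.
have E1 := pochz_merge _ _ _ _ _ fin hM'.
(* Merging at [c - 1] turns [1 - a] into [2 - c], and the additional factor of [(c-1)_(k+1)] is the
   constant [c - 1]. *)
have E2 : pochn (c - 1) k.+1 * pochz (1 - (c - 1)) m%:Z *
    pochn (1 - (c - 1) + m%:Z%:~R) l =
    (-1) ^+ (n.+1 + k.+1) * pochn (c - 1 - n.+1%:R + k.+1%:R) n.+1.
  by apply: pochz_merge => //; lia.
have e1 : 1 - (c - 1) = 2 - c by ring.
have e2 : c - 1 - n.+1%:R + k.+1%:R = c - 1 + k%:R - n%:R.
  by rewrite -!natr1; ring.
rewrite e1 e2 pochnSl subrK /= -pmulrn in E2.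
have B1 : pochn c k != 0 by exact: pochn_neq0.
have B2 : pochn (2 - c) m != 0 by exact: pochn_neq0.
have B3 : pochn (2 - c + m%:R) l != 0.
  have := pochn_neq0 (2 - c) (m + l) c2.
  by rewrite pochnD mulf_eq0 negb_or => /andP[].
have c1' : c - 1 != 0 by rewrite subr_eq0.
have F (i : nat) : i`!%:R != 0 :> K by rewrite pnatr_eq0 -lt0n fact_gt0.
rewrite /kcoef.
move: (F k) (F l) E1 E2 B1 B2 B3.
rewrite addSn addnS !exprS !exprD mulrA mulN1r opprK.
move: (pochn _ M) (pochn (c - 1 + _ - _) _) => P Q.
rewrite -?pmulrn.
move: (pochn c k) (pochn (2 - c) m) (pochn (2 - c + _) l) => B1 B2 B3.
move: (pochn a k) (pochz (1 - a) m1) (pochn (1 - a + _) l) => A1 A2 A3.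
move: (k`!%:R) (l`!%:R) => f g f0 g0 E1 E2 b1 b2 b3.
have s0 i : (-1) ^+ i != 0 :> K by rewrite signr_eq0.
have -> : P = (-1) ^+ M * (-1) ^+ k * (A1 * A2 * A3).
  by rewrite E1; case: (signr_dec M) => ->; case: (signr_dec k) => ->; ring.
have -> : Q = (-1) ^+ n * (-1) ^+ k * ((c - 1) * B1 * B2 * B3).
  by rewrite E2; case: (signr_dec n) => ->; case: (signr_dec k) => ->; ring.
move: (s0 n) (s0 k); move: ((-1) ^+ n) ((-1) ^+ k) => sn sk n0 k0.
by case: (signr_dec M) => ->; case: (signr_dec l) => ->; field;
  rewrite ?n0 ?k0 ?b1 ?b2 ?b3 ?c1' ?f0 ?g0.
Qed.

Lemma not_nonpos_nint c (z : int) :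
  (forall i : int, c != i%:~R) -> not_nonpos_int (c + z%:~R).
Proof.
move=> h n; apply: contraNneq (h (- n%:Z - z)) => e.
by rewrite rmorphB rmorphN /= -pmulrn -e addrK.
Qed.

(** The counterpart at the node [z = 1 - c + j], with the opposite sign. The symbol
    [(2-c+j)_(m-n-1)] is the numerator factor [(z+1)_(m-n-1)]; it is 1 for [m <= n], by truncated
    subtraction. *)
Lemma second_product_residue a c (m1 : int) (m n M j l : nat) :
  (forall z : int, c != z%:~R) ->
  pochz_finite (c - a) (m1 - m%:Z) -> M%:Z = m1 - m%:Z + n%:Z ->
  (j + l = n)%N ->
  pochn (1 - c) m * pochz (c - a) (m1 - m%:Z) *
    (kcoef (1 - c + a) (2 - c) j *
      ((-1) ^+ l * kcoef (c - a + (m1 - m%:Z)%:~R) (c - m%:R) l)) =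
  - ((-1) ^+ (M + n) * (c - 1) *
    (pochn (a - M%:R + (1 - c + j%:R)) M * pochn (2 - c + j%:R) (m - n.+1) /
     (j`!%:R * ((-1) ^+ l * l`!%:R) *
      pochn (2 - c + j%:R - (n.+1 - m)%N%:R) (n.+1 - m)))).
Proof.
move=> cN fin hM hn.
have hM' : M%:Z = m1 - m%:Z + j%:Z + l%:Z by lia.
have cN' (i : int) : 1 - c != i%:~R.
  by apply: contraNneq (cN (1 - i)) => e; rewrite rmorphB /= -e opprB addrC subrK.
have e0 : 1 - (1 - c + a) = c - a by ring.
rewrite -e0 in fin *.
have E1 := pochz_merge _ _ _ _ _ fin hM'.
have -> : a - M%:R + (1 - c + j%:R) = (1 - c + a) - M%:R + j%:R by ring.
(* For [m <= n] two runs exchange their right ends; for [n < m] the run [(1-c)_m] is cut into pieces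
   of lengths [j + 1], [m - n - 1] and [l]. *)
have E2 : pochn (1 - c) m * pochn (2 - c + j%:R - (n.+1 - m)%N%:R) (n.+1 - m) =
   (1 - c) * pochn (2 - c) j * pochn (1 - c + m%:R - l%:R) l *
   pochn (2 - c + j%:R) (m - n.+1).
  have -> : (1 - c) * pochn (2 - c) j = pochn (1 - c) j.+1.
    by rewrite pochnSl; congr (_ * pochn _ _); ring.
  have [hmn|hmn] := leqP m n.
    have -> : (m - n.+1 = 0)%N by lia.
    rewrite pochn0 mulr1 pochn_swap; last by lia.
    congr (_ * pochn _ _); last by lia.
    rewrite natrB; last by lia.
    by rewrite -[n.+1%:R]natr1 -hn natrD; ring.
  have -> : (n.+1 - m = 0)%N by lia.
  rewrite pochn0 mulr1.
  have mE : m = (j.+1 + (m - n.+1) + l)%N by lia.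
  rewrite [pochn _ m](congr1 (pochn _) mE).
  rewrite !pochnD mulrAC.
  have -> : 1 - c + j.+1%:R = 2 - c + j%:R by rewrite -natr1; ring.
  have -> : (j.+1 + (m - n.+1))%N%:R = m%:R - l%:R :> K.
    by rewrite -natrB; last lia; congr _%:R; lia.
  by rewrite addrA.
have b1 : pochn (2 - c) j != 0.
  have := not_nonpos_nint _ 1 cN'.
  by rewrite [1 - c + 1](_ : _ = 2 - c); [exact: pochn_neq0|ring].
have b2 : pochn (1 - c + m%:R - l%:R) l != 0.
  have := not_nonpos_nint _ (m%:Z - l%:Z) cN'.
  by rewrite rmorphB /= -!pmulrn addrA; exact: pochn_neq0.
have b3 : pochn (2 - c + j%:R - (n.+1 - m)%N%:R) (n.+1 - m) != 0.
  have := not_nonpos_nint _ (1 + j%:Z - (n.+1 - m)%N%:Z) cN'.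
  rewrite rmorphB rmorphD /= -!pmulrn.
  rewrite [X in not_nonpos_int X](_ : _ = 2 - c + j%:R - (n.+1 - m)%N%:R).
    exact: pochn_neq0.
  ring.
have F (i : nat) : i`!%:R != 0 :> K by rewrite pnatr_eq0 -lt0n fact_gt0.
have s0 i : (-1) ^+ i != 0 :> K by rewrite signr_eq0.
rewrite /kcoef [pochn (c - _) l]pochn_refl.
have -> : 1 - (c - m%:R) - l%:R = 1 - c + m%:R - l%:R by ring.
move: E2 E1 b1 b2 b3 (F j) (F l); rewrite !exprD.
move: (pochn _ M) => P.
move: (pochn (2 - c) j) (pochn (1 - c + m%:R - l%:R) l) => B1 B2.
move: (pochn (2 - c + j%:R) _) (pochn (2 - c + j%:R - _) _) => G B3.
move: (pochn _ j) (pochz _ _) (pochn (_ + _%:~R) l) => A1 A2 A3.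
move: (j`!%:R) (l`!%:R) (pochn (1 - c) m) => f g W E2 E1 b1 b2 b3 f0 g0.
have -> : P = (-1) ^+ M * (-1) ^+ j * (A1 * A2 * A3).
  by rewrite E1; case: (signr_dec M) => ->; case: (signr_dec j) => ->; ring.
have -> : W = (1 - c) * B1 * B2 * G / B3 by rewrite -E2 mulfK.
rewrite -hn exprD.
by case: (signr_dec M) => ->; case: (signr_dec l) => ->; case: (signr_dec j) => ->;
  field; rewrite ?b1 ?b2 ?b3 ?f0 ?g0.
Qed.

Lemma prod_subr_nat z n : \prod_(i < n) (z - i%:R) = pochn (z + 1 - n%:R) n.
Proof.
rewrite /pochn (reindex_inj rev_ord_inj) /=; apply: eq_bigr => i _.
by rewrite natrB // -natr1; ring.
Qed.

Lemma prod_diff_ord (n k : nat) : (k <= n)%N ->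
  \prod_(j < n.+1 | j != k :> nat) (k%:R - j%:R) =
  k`!%:R * ((-1) ^+ (n - k) * (n - k)`!%:R) :> K.
Proof. by move=> kn; rewrite -prod_diff_nat subnKC. Qed.

(* With the truncated differences [U = n + 1 - m] and [V = m - n - 1], one of
   which is 0, the cases [m <= n] and [n < m] are treated simultaneously. *)
Lemma residue_sum (U V n M : nat) a c :
  (forall z : int, c != z%:~R) -> (M + V < U + n)%N ->
  \sum_(k < U) (pochn (a - M%:R + k%:R) M * pochn (1 + k%:R) V /
    ((\prod_(j < U | j != k :> nat) (k%:R - j%:R)) *
      pochn (c - 1 + k%:R - n%:R) n.+1))
  + \sum_(j < n.+1) (pochn (a - M%:R + (1 - c + j%:R)) M *
      pochn (2 - c + j%:R) V /
    ((\prod_(i < n.+1 | i != j :> nat) (j%:R - i%:R)) *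
       pochn (2 - c + j%:R - U%:R) U)) = 0.
Proof.
move=> cN hd.
(* The nodes are [U] integers followed by [n + 1] translates of [1 - c]; as [c] is not an integer,
   the two families are disjoint. *)
pose x (i : 'I_(U + n.+1)) : K :=
  match fintype.split i with inl k => k%:R | inr j => 1 - c + j%:R end.
have xl k : x (lshift _ k) = k%:R by rewrite /x (unsplitK (inl k)).
have xr j : x (rshift _ j) = 1 - c + j%:R by rewrite /x (unsplitK (inr j)).
have lr (k i : nat) : k%:R = 1 - c + i%:R -> False.
  move=> e; have := cN (1 + i%:Z - k%:Z).
  rewrite rmorphB rmorphD /= -!pmulrn -subr_eq0 => /eqP; apply.
  by rewrite e; ring.
have xI : injective x.
  move=> i j; rewrite -(splitK i) -(splitK j).
  case: (fintype.split i) (fintype.split j) => [k|k] [l|l] /=; rewrite ?xl ?xr.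
  - by move/eqP; rewrite eqr_nat => /eqP /val_inj ->.
  - by move/lr.
  - by move/esym/lr.
  - by move/addrI/eqP; rewrite eqr_nat => /eqP /val_inj ->.
pose p : {poly K} := \prod_(i < M) ('X - (- (a - M%:R + i%:R))%:P) *
                     \prod_(i < V) ('X - (- (1 + i%:R))%:P).
have pE z : p.[z] = pochn (a - M%:R + z) M * pochn (1 + z) V.
  rewrite /p hornerM !horner_prod; congr (_ * _); apply: eq_bigr => i _;
  rewrite hornerXsubC; ring.
(* The degree of [p] is [M + V], so that [hd] bounds it by the number of nodes minus two. *)
have sp : (size p < U + n.+1)%N.
  rewrite /p size_mul ?monic_neq0 ?monic_prod_XsubC //.
  by rewrite !size_prod_XsubC /index_enum -!enumT !size_enum_ord; lia.
have := divided_difference_eq0 _ x p xI sp.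
rewrite big_split_ord /= => E; rewrite -[RHS]E.
congr (_ + _); apply: eq_bigr => k _.
  rewrite big_split_ord /= xl pE; congr (_ / (_ * _)).
    apply: eq_big => [j|j _]; last by rewrite xl.
    by rewrite (inj_eq (@lshift_inj _ _)).
  rewrite (eq_bigl xpredT); last by move=> j; rewrite eq_rlshift.
  under eq_bigr do rewrite xr opprD addrA.
  by rewrite prod_subr_nat -natr1; congr pochn; ring.
rewrite big_split_ord /= xr pE [X in _ / X]mulrC; congr (_ * pochn _ _ / (_ * _)).
- by ring.
- rewrite (eq_bigl xpredT); last by move=> j; rewrite eq_lrshift.
  under eq_bigr do rewrite xl.
  by rewrite prod_subr_nat; congr pochn; ring.
- apply: eq_big => [j|j _]; first by rewrite (inj_eq (@rshift_inj _ _)).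
  by rewrite xr; ring.
Qed.

(** * Cancellation of the coefficients of high order *)

Definition cauchy_coef (u v : nat -> K) (n : nat) : K :=
  \sum_(i < n.+1) u i * v (n - i)%N.

(** The first product carries [t^m], hence the index [n - m]. The bound [m - m1 <= n] makes [M] a
    natural number, and [m1 <= n] is the degree condition of [residue_sum], both for [m <= n] and
    for [n < m]. *)
Lemma coef_identity a c (m1 : int) (m n : nat) :
  (forall z : int, c != z%:~R) ->
  pochz_finite (1 - a) m1 -> pochz_finite (c - a) (m1 - m%:Z) ->
  m1 <= n%:Z -> m%:Z - m1 <= n%:Z ->
  (if (m <= n)%N then pochz (1 - a) m1 / pochn (2 - c) m *
    cauchy_coef (kcoef a c)
      (fun l => (-1) ^+ l * kcoef (1 - a + m1%:~R) (2 - c + m%:R) l) (n - m)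
  else 0) =
  pochn (1 - c) m * pochz (c - a) (m1 - m%:Z) *
    cauchy_coef (kcoef (1 - c + a) (2 - c))
      (fun l => (-1) ^+ l * kcoef (c - a + (m1 - m%:Z)%:~R) (c - m%:R) l) n.
Proof.
move=> cN f1 f2 h1 h2.
have [M hM] : exists M : nat, M%:Z = m1 - m%:Z + n%:Z.
  by exists (absz (m1 - m%:Z + n%:Z)); lia.
have c0 : not_nonpos_int c.
  by have := not_nonpos_nint _ 0 cN; rewrite addr0.
have c2 : not_nonpos_int (2 - c).
  move=> i; apply: contraNneq (cN (2 + i%:Z)) => e.
  by rewrite rmorphD /= -pmulrn -[i%:R]opprK -e; apply/eqP; ring.
have c1 : c != 1 by exact: (cN 1).
rewrite /cauchy_coef [RHS]mulr_sumr.
under [RHS]eq_bigr => j _.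
  rewrite (second_product_residue _ _ _ _ n M _ _ cN f2 hM);
    last by rewrite subnKC // -ltnS.
  over.
rewrite sumrN -mulr_sumr.
have := residue_sum (n.+1 - m) (m - n.+1) n M a c cN.
have -> : (M + (m - n.+1) < n.+1 - m + n)%N by lia.
move=> /(_ isT) /eqP; rewrite addrC addr_eq0 => /eqP.
under eq_bigr => j _.
  rewrite prod_diff_ord; last by rewrite -ltnS.
  over.
move=> ->; rewrite mulrN opprK.
(* For [n < m] there are no integer nodes, so the second product alone has coefficient 0. *)
case: leqP => hmn; last first.
  have U0 : (n.+1 - m = 0)%N by apply/eqP; rewrite subn_eq0.
  by rewrite U0 big_ord0 mulr0.
rewrite !mulr_sumr subSn //; apply: eq_bigr => k _.
have -> : (m - n.+1 = 0)%N by lia.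
have hk : (k <= n - m)%N by rewrite -ltnS.
rewrite (first_product_residue _ _ _ _ n M _ _ c0 c2 c1 f1 hM); last by lia.
by rewrite prod_diff_ord // pochn0 mulr1.
Qed.

(** * Kummer's transformation on coefficients *)

(** This is 2F1(-n, b; c; 1), because [(-n)_i / i!] is [(-1)^i] times a binomial coefficient. The
    induction on [n] shifts [c] to [c + 1]. *)
Lemma chu_vandermonde n b c : not_nonpos_int c ->
  \sum_(i < n.+1) 'C(n, i)%:R * ((-1) ^+ i * (pochn b i / pochn c i)) =
  pochn (c - b) n / pochn c n.
Proof.
elim: n c => [|n IH] c hc; first by rewrite big_ord1 !pochn0 bin0 !mul1r.
have hc1 : not_nonpos_int (c + 1).
  move=> i; apply: contraNneq (hc i.+1) => e.
  by rewrite -natr1 opprD -e addrK.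
have cn0 : c != 0 by have := hc 0; rewrite oppr0.
have -> : pochn (c - b) n.+1 / pochn c n.+1 =
    (c - b) / c * (pochn (c + 1 - b) n / pochn (c + 1) n).
  have -> : c + 1 - b = c - b + 1 by ring.
  by rewrite !pochnSl; field; rewrite cn0 pochn_neq0.
rewrite -IH // mulr_sumr.
pose f i := (-1) ^+ i * (pochn b i / pochn c i).
(* Pascal's rule groups the sum for [n + 1] into such pairs of neighbours, each of which is a
   multiple of a term for [n] and [c + 1]. *)
have step i : f i + f i.+1 =
    (c - b) / c * ((-1) ^+ i * (pochn b i / pochn (c + 1) i)).
  have e : c * pochn (c + 1) i = pochn c i * (c + i%:R) by rewrite -pochnSl pochnS.
  have p0 := pochn_neq0 _ i hc; have p1 := pochn_neq0 _ i hc1.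
  have ci : c + i%:R != 0 by rewrite addr_eq0.
  have -> : pochn (c + 1) i = pochn c i * (c + i%:R) / c.
    by rewrite -e mulrC mulKf.
  by rewrite /f exprS !pochnS; field; rewrite cn0 p0 ci.
transitivity (\sum_(i < n.+1) 'C(n, i)%:R * (f i + f i.+1)); last first.
  by apply: eq_bigr => i _; rewrite step; ring.
under [RHS]eq_bigr do rewrite mulrDr.
rewrite big_split /= big_ord_recl [X in _ = X + _]big_ord_recl /=.
rewrite !bin0 -addrA; congr (_ + _).
under eq_bigr do rewrite /bump /= add1n binS natrD mulrDl.
rewrite big_split /=; congr (_ + _).
by rewrite big_ord_recr /= bin_small // mul0r addr0.
Qed.

(** [kcoef 1 1 k] is [1 / k!], so the sum is the coefficient of [e^t] times 1F1(c-a; c; -t);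
    Chu-Vandermonde with [b = c - a] evaluates it. *)
Lemma kcoef_kummer a c n : not_nonpos_int c ->
  cauchy_coef (kcoef 1 1) (fun k => (-1) ^+ k * kcoef (c - a) c k) n =
  kcoef a c n.
Proof.
move=> hc.
have F (i : nat) : i`!%:R != 0 :> K by rewrite pnatr_eq0 -lt0n fact_gt0.
have p1 k : kcoef 1 1 k = k`!%:R^-1.
  rewrite /kcoef divff ?mul1r // pochn_neq0 // => i.
  by rewrite -addr_eq0 nat1r pnatr_eq0.
rewrite /cauchy_coef (reindex_inj rev_ord_inj) /=.
rewrite [RHS]/kcoef -[a in RHS](subKr c) -chu_vandermonde // mulr_suml.
apply: eq_bigr => i _.
have hi : (i <= n)%N by rewrite -ltnS.
rewrite subSS (subKn hi) p1 /kcoef -(bin_fact hi) !natrM.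
have C0 : 'C(n, i)%:R != 0 :> K by rewrite pnatr_eq0 -lt0n bin_gt0.
have p0 := pochn_neq0 _ i hc.
by field; rewrite C0 p0 !F.
Qed.

(** * Taylor coefficients of polynomials *)

Lemma derivable_poly (p : {poly K}) (x : K) : derivable (horner p) x 1.
Proof.
elim/poly_ind: p => [|p r ih].
  rewrite (_ : horner 0 = cst 0); first exact: derivable_cst.
  by apply/funext => y; rewrite horner0.
rewrite (_ : horner _ = (fun y => p.[y] * y) + cst r); last first.
  by apply/funext => y; rewrite !hornerE.
apply: derivableD; last exact: derivable_cst.
by apply: derivableM; [exact: ih|exact: derivable_id].
Qed.

Lemma derive1_poly (p : {poly K}) : derive1 (horner p) = horner p^`().
Proof.
apply/funext => x; elim/poly_ind: p => [|p r ih].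
  rewrite deriv0 (_ : horner 0 = cst 0); first by rewrite derive1_cst.
  by apply/funext => y; rewrite horner0.
rewrite [X in derive1 X](_ : _ = (fun y => p.[y] * y) + cst r); last first.
  by apply/funext => y; rewrite !hornerE.
have dM : derivable (fun y => p.[y] * y) x 1.
  by apply: derivableM; [exact: derivable_poly|exact: derivable_id].
rewrite derive1E deriveD // -[X in _ + X]derive1E derive1_cst addr0.
rewrite deriveM //; last exact: derivable_poly.
rewrite derive_id -derive1E ih derivD derivC addr0 derivM derivX mulr1.
by rewrite !hornerE addrC /GRing.scale /= mulr1 mulrC.
Qed.

Lemma taylor_coef_poly (p : {poly K}) n : taylor_coef (horner p) n = p`_n.
Proof.
rewrite /taylor_coef (_ : derive1n n (horner p) = horner p^`(n)); last first.
  elim: n => [|n IH]; first by rewrite derivn0.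
  by rewrite derive1nS IH derive1_poly derivnS.
rewrite horner_coef0 coef_derivn addn0 ffactnn -[p`_n *+ _]mulr_natr.
by rewrite mulfK // pnatr_eq0 -lt0n fact_gt0.
Qed.

(** * Cauchy products of geometrically bounded series *)

(** One fixed ratio suffices, since the terms of a Kummer series decrease faster than any geometric
    sequence. The value 1/8 absorbs the factor [n^3] in [series_cauchy_coef_error]. *)
Definition geometric_bound u : Prop :=
  exists C : K, forall k, `|u k| <= C * 8^-1 ^+ k.

Lemma geometric_bound_ge0 u C :
  (forall k, `|u k| <= C * 8^-1 ^+ k) -> 0 <= C.
Proof. by move=> /(_ 0); rewrite expr0 mulr1; apply: le_trans. Qed.

Lemma series_cauchy_coef u v n :
  series (cauchy_coef u v) n = \sum_(i < n) u i * series v (n - i)%N.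
Proof.
rewrite /series /= big_mkord.
elim: n => [|n IH]; first by rewrite !big_ord0.
rewrite big_ord_recr IH /cauchy_coef !big_ord_recr /=.
rewrite subSnn big_nat1 subnn addrA; congr (_ + _).
rewrite -big_split; apply: eq_bigr => i _ /=.
by rewrite subSn ?[in RHS]big_nat_recr //= ?mulrDr // ltnW.
Qed.

(* The difference is the sum of [u i * v j] over [i, j < n <= i + j]: at most n^2
   terms, each bounded by [C * D / 8 ^ n], and n^3 <= 8^n. *)
Lemma series_cauchy_coef_error u v C D n :
  (forall k, `|u k| <= C * 8^-1 ^+ k) -> (forall k, `|v k| <= D * 8^-1 ^+ k) ->
  n%:R * `|series u n * series v n - series (cauchy_coef u v) n| <= C * D.
Proof.
move=> hu hv.
have C0 := geometric_bound_ge0 _ _ hu; have D0 := geometric_bound_ge0 _ _ hv.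
have h8 k : 0 <= 8^-1 ^+ k :> K by rewrite exprn_ge0 // invr_ge0 ler0n.
have -> : series u n * series v n - series (cauchy_coef u v) n =
  \sum_(i < n) u i * \sum_((n - i)%N <= j < n) v j.
  rewrite series_cauchy_coef [series u n]/series /= big_mkord mulr_suml -sumrB.
  apply: eq_bigr => i _; rewrite -mulrBr; congr (_ * _).
  rewrite /series /= (@big_cat_nat _ _ _ (n - i)%N) ?leq_subr //=.
  by rewrite addrC addrK.
have step (i : 'I_n) : `|u i * \sum_((n - i)%N <= j < n) v j| <=
    n%:R * (C * D * 8^-1 ^+ n).
  rewrite normrM.
  apply: (@le_trans _ _ (\sum_((n - i)%N <= j < n) C * 8^-1 ^+ i * (D * 8^-1 ^+ j))).
    rewrite -mulr_sumr ler_pM // (le_trans (ler_norm_sum _ _ _)) //.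
    by apply: ler_sum.
  apply: (@le_trans _ _ (\sum_((n - i)%N <= j < n) C * D * 8^-1 ^+ n)).
    rewrite big_nat_cond [leRHS]big_nat_cond; apply: ler_sum => j.
    rewrite andbT => /andP[ij _].
    rewrite mulrACA -exprD ler_wpM2l ?mulr_ge0 //.
    by rewrite ler_wiXn2l ?invr_ge0 ?ler0n ?invf_le1 ?ler1n //; lia.
  rewrite sumr_const_nat -[_ *+ (n - _)]mulr_natl ler_wpM2r ?mulr_ge0 // ler_nat; lia.
apply: (@le_trans _ _ (n%:R * (n%:R * (n%:R * (C * D * 8^-1 ^+ n))))).
  rewrite ler_wpM2l // (le_trans (ler_norm_sum _ _ _)) //.
  apply: (@le_trans _ _ (\sum_(i < n) n%:R * (C * D * 8^-1 ^+ n))).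
    by apply: ler_sum => i _; exact: step.
  by rewrite sumr_const card_ord [leRHS]mulr_natl lexx.
have -> : n%:R * (n%:R * (n%:R * (C * D * 8^-1 ^+ n))) =
    C * D * ((n * n * n)%N%:R * 8^-1 ^+ n) by rewrite !natrM; ring.
rewrite ler_piMr ?mulr_ge0 //.
rewrite exprVn ler_pdivrMr ?exprn_gt0 // mul1r -natrX ler_nat.
rewrite -[X in (X ^ n)%N]/(2 * 2 * 2)%N.
by rewrite !expnMn !leq_mul // ltnW // ltn_expl.
Qed.

(** The two properties of the complex field on which the convergence arguments rest; [complex_archi]
    and [complex_geometric_bound_cvg] establish them. *)
Hypothesis K_archi : forall x : K, exists n : nat, `|x| <= n%:R.
Hypothesis K_complete : forall u, geometric_bound u -> cvgn (series u).

Lemma cauchy_product u v : geometric_bound u -> geometric_bound v ->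
  series (cauchy_coef u v) @ \oo --> limn (series u) * limn (series v).
Proof.
move=> hu hv; have cu := K_complete _ hu; have cv := K_complete _ hv.
case: hu hv => C hC [D hD].
have e : (fun n => series u n * series v n - series (cauchy_coef u v) n) @ \oo
    --> (0 : K).
  apply/cvgr0Pnorm_lt => e e0.
  (* The error is at most [C * D / n], which is below [e] once [n > n0]. *)
  have [n0 hn0] := K_archi (C * D / e).
  exists n0.+1 => // n /= hn.
  have n0' : 0 < n%:R :> K by rewrite ltr0n; lia.
  rewrite -(ltr_pM2l n0') (le_lt_trans (series_cauchy_coef_error _ _ _ _ n hC hD)) //.
  rewrite -ltr_pdivrMr //.
  apply: (@le_lt_trans _ _ n0%:R); last by rewrite ltr_nat.
  apply: le_trans hn0; rewrite ger0_norm // mulr_ge0 ?invr_ge0 ?(ltW e0) //.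
  by rewrite mulr_ge0 // (geometric_bound_ge0 _ _ hC, geometric_bound_ge0 _ _ hD).
rewrite -[X in _ --> X]subr0.
rewrite (_ : series (cauchy_coef u v) = (fun n => series u n * series v n -
  (series u n * series v n - series (cauchy_coef u v) n))); last first.
  by apply/funext => n; rewrite opprB addrC subrK.
by apply: cvgB => //; apply: cvgM.
Qed.

(** * Kummer functions and their transformation *)

Lemma kcoefS a b k : kcoef a b k.+1 =
  kcoef a b k * ((a + k%:R) / (b + k%:R) / k.+1%:R).
Proof. by rewrite /kcoef !pochnS factS natrM !invfM; ring. Qed.

(** The ratio of consecutive terms, [(a+k) t / ((b+k) (k+1))], tends to 0 and is at most 1/8 in
    absolute value from [k0] on. *)
Lemma kcoef_geometric_bound a b t : not_nonpos_int b ->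
  geometric_bound (fun k => kcoef a b k * t ^+ k).
Proof.
move=> hb; set u := fun k => _.
have [na hna] := K_archi a; have [nb hnb] := K_archi b.
have [nt hnt] := K_archi t.
(* The three summands give [|a + k| <= 2k], [k <= 2|b + k|] and [32 nt <= k]; together,
   [16 * 2k * nt <= k^2 <= 2|b + k| (k + 1)]. *)
pose k0 := (na + 2 * nb + 32 * nt)%N.
have step k : (k0 <= k)%N -> `|u k.+1| <= `|u k| * 8^-1.
  move=> hk.
  have -> : u k.+1 = u k * ((a + k%:R) / (b + k%:R) / k.+1%:R * t).
    by rewrite /u kcoefS exprSr; ring.
  rewrite normrM ler_wpM2l // !normrM !normfV normr_nat.
  have bk : 0 < `|b + k%:R| by rewrite normr_gt0 addr_eq0.
  have h1 : `|a + k%:R| <= (2 * k)%N%:R.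
    rewrite (le_trans (ler_normD _ _)) // normr_nat.
    rewrite (le_trans (lerD hna (lexx _))) // -natrD ler_nat; lia.
  have h2 : k%:R <= 2 * `|b + k%:R|.
    have h3 : k%:R <= `|b + k%:R| + nb%:R.
      rewrite -[X in X <= _]normr_nat -[X in `|X|](addKr b) addrC.
      by rewrite (le_trans (ler_normB _ _)) // lerD.
    have h4 : (2 * k)%N%:R <= 2 * `|b + k%:R| + (2 * nb)%N%:R :> K.
      by rewrite !natrM -mulrDr ler_wpM2l.
    rewrite -(lerD2r (2 * nb)%N%:R) (le_trans _ h4) // -natrD ler_nat; lia.
  rewrite (_ : _ * `|t| = `|a + k%:R| * `|t| / (`|b + k%:R| * k.+1%:R)); last first.
    by rewrite invfM; ring.
  rewrite ler_pdivrMr; last first.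
    by rewrite mulr_gt0 // ltr0n.
  apply: (@le_trans _ _ ((2 * k)%N%:R * nt%:R)); first by rewrite ler_pM.
  rewrite -(ler_pM2l (_ : 0 < 16)) ?ltr0n //.
  have -> : 16 * (8^-1 * (`|b + k%:R| * k.+1%:R)) = 2 * `|b + k%:R| * k.+1%:R.
    by field.
  apply: (@le_trans _ _ (k%:R * k%:R)).
    rewrite -!natrM ler_nat.
    by apply: (@leq_trans (k * (32 * nt))); [lia|rewrite leq_mul //; lia].
  by rewrite ler_pM // ler_nat.
have stepd (d : nat) : `|u (k0 + d)%N| <= `|u k0| * 8^-1 ^+ d.
  elim: d => [|d IH]; first by rewrite addn0 expr0 mulr1.
  rewrite addnS (le_trans (step _ (leq_addr _ _))) // exprSr mulrA.
  by rewrite ler_wpM2r // invr_ge0 ler0n.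
(* The sum dominates each of its terms: the term [j = k] serves for [k <= k0], the term [j = k0] for
   the tail. *)
exists (\sum_(j < k0.+1) `|u j| * 8 ^+ j) => k.
have single (j : 'I_k0.+1) : `|u j| * 8 ^+ j <= \sum_(j < k0.+1) `|u j| * 8 ^+ j.
  rewrite [leRHS](bigD1 j) //= lerDl; apply: sumr_ge0 => i _.
  by apply: mulr_ge0 => //; exact: exprn_ge0.
have e8 j : 8 ^+ j * 8^-1 ^+ j = 1 :> K.
  by rewrite -exprMn divff ?expr1n // pnatr_eq0.
have p8 j : 0 <= 8^-1 ^+ j :> K by rewrite exprn_ge0 // invr_ge0 ler0n.
have [hk|hk] := leqP k k0.
  have := single (Ordinal (hk : (k < k0.+1)%N)).
  move/(ler_wpM2r (p8 k)); apply: le_trans.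
  by rewrite /= -mulrA e8 mulr1.
rewrite -(subnKC (ltnW hk)) (le_trans (stepd _)) //.
rewrite exprD mulrA ler_wpM2r //.
have /(ler_wpM2r (p8 k0)) := single ord_max.
by rewrite /= -mulrA e8 mulr1.
Qed.

Lemma hyp1F1E a b t :
  hyp1F1 a b t = limn (series (fun k => kcoef a b k * t ^+ k)).
Proof.
rewrite /hyp1F1; congr (limn (series _)); apply/funext => k.
by rewrite /kcoef; ring.
Qed.

Lemma hyp1F1_prod_cvg a b c (d t : K) : not_nonpos_int b -> not_nonpos_int d ->
  series (fun n => cauchy_coef (kcoef a b)
     (fun k => (-1) ^+ k * kcoef c d k) n * t ^+ n) @ \oo -->
  hyp1F1 a b t * hyp1F1 c d (- t).
Proof.
move=> hb hd; rewrite !hyp1F1E.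
have := cauchy_product _ _
  (kcoef_geometric_bound a b t hb)
  (kcoef_geometric_bound c d (- t) hd).
apply: cvg_trans; apply: near_eq_cvg; apply: nearW => n.
rewrite /series /=; apply: eq_bigr => {}n _.
rewrite /cauchy_coef mulr_suml; apply: eq_bigr => i _.
have -> : t ^+ n = t ^+ i * t ^+ (n - i) by rewrite -exprD subnKC // -ltnS.
by rewrite (exprNn t); ring.
Qed.

(** Here [hyp1F1 1 1 t] stands for [e^t]. *)
Lemma hyp1F1_kummer a c t : not_nonpos_int c ->
  hyp1F1 a c t = hyp1F1 1 1 t * hyp1F1 (c - a) c (- t).
Proof.
move=> hc; rewrite [LHS]hyp1F1E; apply: cvg_lim => //.
have h1 : not_nonpos_int (1 : K).
  by move=> i; rewrite -addr_eq0 nat1r pnatr_eq0.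
have := hyp1F1_prod_cvg 1 1 (c - a) c t h1 hc.
by under eq_fun do rewrite kcoef_kummer //.
Qed.

(** Kummer's transformation of 1F1(0; 1; t), a series whose only nonzero term is the constant 1. *)
Lemma hyp1F1_exp_neg t : hyp1F1 1 1 t * hyp1F1 1 1 (- t) = 1 :> K.
Proof.
have h1 : not_nonpos_int (1 : K).
  by move=> i; rewrite -addr_eq0 nat1r pnatr_eq0.
transitivity (hyp1F1 0 1 t : K); first by rewrite (hyp1F1_kummer 0) // subr0.
rewrite hyp1F1E; apply: cvg_lim => //.
apply: cvg_near_cst; exists 1%N => // -[//|n] _.
rewrite /series /= big_nat_recl // big1 ?addr0.
  by rewrite /kcoef !pochn0 fact0 expr0 divr1 mulr1 divr1.
by move=> i _; rewrite /kcoef pochnSl !mul0r.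
Qed.

(** The arguments being opposite, the two exponential factors cancel. *)
Lemma hyp1F1_kummer_prod a b c (d t : K) : not_nonpos_int b -> not_nonpos_int d ->
  hyp1F1 a b t * hyp1F1 c d (- t) =
  hyp1F1 (b - a) b (- t) * hyp1F1 (d - c) d t.
Proof.
move=> hb hd; rewrite hyp1F1_kummer // (hyp1F1_kummer c) // opprK.
have := hyp1F1_exp_neg t => e.
set x := hyp1F1 1 1 t in e *; set y := hyp1F1 1 1 _ in e *.
by rewrite mulrACA e mul1r.
Qed.

(** * Symmetry and polynomiality of the left-hand side *)

Definition kummer_side (m1 m2 : int) a c t : K :=
  pochz (1 - a) m1 * t ^ pos_part m2 / pochz (2 - c) m2
    * (hyp1F1 a c t * hyp1F1 (1 - a + m1%:~R) (2 - c + m2%:~R) (- t)).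

Lemma pochz_reflect c (m : int) :
  (-1) ^+ `|m|%N / pochz c (- m) = pochz (1 - c) m.
Proof.
case: m => [[|j]|j].
- by rewrite oppr0 /= !pochn0 divr1.
- rewrite (_ : - _ = Negz j); last by rewrite NegzE.
  by rewrite /= invfM invrK mulrA divff ?mul1r // signr_eq0.
- by rewrite NegzE opprK /= opprB addrCA subrr addr0.
Qed.

(** The substitution of [(m1 - m2, -m2, 1 - c + a, 2 - c)] for [(m1, m2, a, c)] is an involution, so
    it exchanges the two products up to sign. *)
Lemma kummer_lhsE (m1 m2 : int) a c t : well_defined m1 m2 a c ->
  kummer_lhs m1 m2 a c t = kummer_side m1 m2 a c t -
   (-1) ^+ `|m2|%N * kummer_side (m1 - m2) (- m2) (1 - c + a) (2 - c) t.
Proof.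
move=> [[h1 h2 h3 h4] _ _]; rewrite /kummer_lhs /kummer_side -!mulrA.
congr (_ - _).
have -> : 2 - (2 - c) = c by ring.
have -> : 1 - (1 - c + a) = c - a by ring.
rewrite -(pochz_reflect c) [hyp1F1 (1 - a) _ _ * _]mulrC.
have -> : c + (- m2)%:~R = c - m2%:~R by rewrite rmorphN.
rewrite (hyp1F1_kummer_prod (a - m1%:~R)) //.
rewrite (_ : c - m2%:~R - (a - m1%:~R) = c - a + (m1 - m2)%:~R); last first.
  by rewrite rmorphB /=; ring.
rewrite (_ : 2 - c - (1 - a) = 1 - c + a); last by ring.
by ring.
Qed.

Lemma kummer_side_poly (m1 : int) (m : nat) a c :
  (forall z : int, c != z%:~R) ->
  pochz_finite (1 - a) m1 -> pochz_finite (c - a) (m1 - m%:Z) ->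
  exists2 P : {poly K}, (size P <= maxn `|m1| `|(m%:Z - m1)%R|)%N &
    forall t, kummer_side m1 m%:Z a c t -
      (-1) ^+ m * kummer_side (m1 - m%:Z) (- m%:Z) (1 - c + a) (2 - c) t = P.[t].
Proof.
move=> cN f1 f2; set N := maxn _ _.
pose e1 := cauchy_coef (kcoef a c)
      (fun l => (-1) ^+ l * kcoef (1 - a + m1%:~R) (2 - c + m%:R) l).
pose e2 := cauchy_coef (kcoef (1 - c + a) (2 - c))
      (fun l => (-1) ^+ l * kcoef (c - a + (m1 - m%:Z)%:~R) (c - m%:R) l).
pose c1 := pochz (1 - a) m1 / pochn (2 - c) m.
pose c2 := pochn (1 - c) m * pochz (c - a) (m1 - m%:Z).
(* [w n] is the coefficient of [t^n] in the difference of the two products. *)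
pose w n := (if (m <= n)%N then c1 * e1 (n - m)%N else 0) - c2 * e2 n.
have w0 n : (N <= n)%N -> w n = 0.
  rewrite geq_max => /andP[n1 n2].
  by rewrite /w coef_identity ?subrr //; lia.
have nn (z : int) : not_nonpos_int (c + z%:~R) by exact: not_nonpos_nint.
have nn2 (z : int) : not_nonpos_int (2 - c + z%:~R).
  apply: not_nonpos_nint => i; apply: contraNneq (cN (2 - i)) => e.
  by rewrite rmorphB /= -e; apply/eqP; ring.
have c_np : not_nonpos_int c by have := nn 0; rewrite addr0.
have c2_np : not_nonpos_int (2 - c) by have := nn2 0; rewrite addr0.
exists (\poly_(n < N) w n); first exact: size_poly.
move=> t.
have lim1 := hyp1F1_prod_cvg a c (1 - a + m1%:~R) (2 - c + m%:R) t c_np (nn2 m).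
have lim2 := hyp1F1_prod_cvg (1 - c + a) (2 - c)
  (c - a + (m1 - m%:Z)%:~R) (c - m%:R) t c2_np.
have {}lim2 : series (fun n => e2 n * t ^+ n) @ \oo -->
    hyp1F1 (1 - c + a) (2 - c) t *
    hyp1F1 (c - a + (m1 - m%:Z)%:~R) (c - m%:R) (- t).
  by apply: lim2; have := nn (- m%:Z); rewrite rmorphN.
set L1 := _ * _ in lim1; set L2 := _ * _ in lim2.
have -> : kummer_side m1 m a c t -
    (-1) ^+ m * kummer_side (m1 - m%:Z) (- m%:Z) (1 - c + a) (2 - c) t =
    c1 * t ^+ m * L1 - c2 * L2.
  rewrite /kummer_side -/L1 /c1 /c2.
  have -> : pos_part m%:Z = m by rewrite /pos_part max_r.
  have -> : pos_part (- m%:Z) = 0 by rewrite /pos_part max_l // oppr_le0.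
  rewrite (_ : 2 - (2 - c) = c); last by ring.
  rewrite (_ : 1 - (1 - c + a) = c - a); last by ring.
  have -> : c + (- m%:Z)%:~R = c - m%:R by rewrite rmorphN.
  rewrite -/L2 expr0z mulr1.
  have -> : pochn (1 - c) m = (-1) ^+ m / pochz c (- m%:Z).
    exact: esym (pochz_reflect c m).
  by rewrite -exprnP; ring.
(* Cutting the second series at [k + m] matches the first one, which is shifted by [t^m]. For
   [k >= N] the difference of the partial sums is then constant in [k]. *)
have limS : (fun k => c1 * t ^+ m * series (fun n => e1 n * t ^+ n) k -
    c2 * series (fun n => e2 n * t ^+ n) (k + m)%N) @ \oo -->
    c1 * t ^+ m * L1 - c2 * L2.
  apply: cvgB; first by apply: cvgM => //; exact: cvg_cst.
  apply: cvgM; first exact: cvg_cst.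
  by rewrite (cvg_shiftn m (series (fun n => e2 n * t ^+ n))).
rewrite -(cvg_lim _ limS) //; apply: cvg_lim => //.
apply: cvg_near_cst; exists N => // k /= Nk.
transitivity (\sum_(0 <= n < k + m) w n * t ^+ n).
  rewrite /w; under eq_bigr do rewrite mulrBl.
  rewrite sumrB; congr (_ - _).
    rewrite addnC (@big_cat_nat _ _ _ m) ?leq_addr //= big_nat_cond big1.
      rewrite add0r -[X in \sum_(X <= _ < _) _]add0n big_addn addKn mulr_sumr.
      by apply: eq_bigr => n _; rewrite leq_addl addnK exprD; ring.
    by move=> n /andP[/andP[_ nm] _]; rewrite leqNgt nm mul0r.
  by rewrite mulr_sumr; apply: eq_bigr => n _; rewrite mulrA.
rewrite horner_poly (@big_cat_nat _ _ _ N) //=; last exact: leq_trans (leq_addr _ _).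
rewrite big_mkord [X in _ + X]big_nat_cond [X in _ + X]big1 ?addr0 //.
by move=> n /andP[/andP[Nn _] _]; rewrite w0 // mul0r.
Qed.

Lemma kummer_lhs_gamma1 (m1 m2 : int) a t : well_defined m1 m2 a 1 ->
  kummer_lhs m1 m2 a 1 t = 0.
Proof.
move=> wd; rewrite kummer_lhsE //; case: wd => -[_ _ h3 h4] _ _.
(* For [c = 1] the lower parameters are [1 + m2] and [1 - m2], and one of them is a non-positive
   integer unless [m2 = 0]. The involution then fixes all parameters. *)
have m0 : m2 = 0.
  case: m2 h3 h4 => [[//|j]|j] h3 h4.
    by have := h4 j; rewrite -pmulrn -natr1 opprD addrCA subrr addr0 eqxx.
  have := h3 j; rewrite NegzE rmorphN /= -pmulrn -[j.+1%:R]natr1 opprD.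
  by rewrite (_ : 2 - 1 + _ = - j%:R) ?eqxx //; ring.
rewrite m0 /kummer_side expr0 mul1r oppr0 subr0.
have e21 : 2 - 1 = 1 :> K by ring.
rewrite e21 [2 - 1]e21.
by rewrite subrr add0r subrr.
Qed.

(** The parameter [c] excludes the integers up to 0, the parameter [2 - c] those from 2 on. *)
Lemma well_defined_nonint (m1 m2 : int) a c : well_defined m1 m2 a c ->
  c != 1 -> forall z : int, c != z%:~R.
Proof.
move=> [[h1 h2 _ _] _ _] c1 [[|[|z]]|z].
- by have := h1 0; rewrite oppr0.
- exact: c1.
- have := h2 z; apply: contraNneq => ->.
  by rewrite -pmulrn -!natr1; apply/eqP; ring.
- by have := h1 z.+1; rewrite NegzE rmorphN.
Qed.

Lemma kummer_lhs_poly (m1 m2 : int) a c : well_defined m1 m2 a c ->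
  exists2 P : {poly K}, (size P <= maxn `|m1| `|(m2 - m1)%R|)%N &
    forall t, kummer_lhs m1 m2 a c t = P.[t].
Proof.
move=> wd; have [c1|c1] := eqVneq c 1.
  rewrite c1 in wd *; exists 0; first by rewrite size_poly0.
  by move=> t; rewrite kummer_lhs_gamma1 // horner0.
have cN := well_defined_nonint _ _ _ _ wd c1.
have [_ [f1 _ _ f2] _] := wd.
case: m2 wd f2 => [m|m'] wd f2.
  have [P sP hP] := kummer_side_poly m1 m a c cN f1 f2.
  by exists P => // t; rewrite kummer_lhsE.
(* For negative [m2] the involution leads to index [m]. It exchanges the entries of the maximum in
   the degree bound and multiplies the difference by [-(-1)^m]. *)
pose m := m'.+1; have mE : Negz m' = - m%:Z by rewrite NegzE.
rewrite mE in wd f2 *.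
have cN' (z : int) : 2 - c != z%:~R.
  apply: contraNneq (cN (2 - z)) => e.
  by rewrite rmorphB /= -e; apply/eqP; ring.
have f1' : pochz_finite (1 - (1 - c + a)) (m1 - - m%:Z).
  by rewrite (_ : 1 - _ = c - a) //; ring.
have f2' : pochz_finite (2 - c - (1 - c + a)) (m1 - - m%:Z - m%:Z).
  by rewrite (_ : 2 - c - _ = 1 - a) ?opprK ?addrK //; ring.
have [P sP hP] := kummer_side_poly (m1 - - m%:Z) m (1 - c + a) (2 - c) cN' f1' f2'.
exists (- (-1) ^+ m *: P).
  rewrite (leq_trans (size_scale_leq _ _)) // (leq_trans sP) //; lia.
move=> t; rewrite hornerZ -hP kummer_lhsE // opprK addrK abszN /=.
rewrite (_ : 1 - (2 - c) + (1 - c + a) = a); last by ring.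
rewrite (_ : 2 - (2 - c) = c); last by ring.
rewrite -/m.
by case: (signr_dec m) => ->; ring.
Qed.

End Kummer.

(** * Archimedean property and completeness of the complex field *)

Section Cplx.
Import Normc.
Local Open Scope classical_set_scope.
Local Open Scope complex_scope.
Variable R : realType.
(* The bare type [R[i]] carries no topology. *)
Local Notation C := (R[i] : numFieldType).

Lemma normc_ge0 (x : R[i]) : 0 <= normc x.
Proof. by rewrite -lecR -[(normc x)%:C]/(`|x|) normr_ge0. Qed.

Lemma Re_le_normc (x : R[i]) : `|complex.Re x| <= normc x.
Proof.
case: x => x y /=; rewrite -sqrtr_sqr ler_wsqrtr // lerDl; exact: sqr_ge0.
Qed.

Lemma Im_le_normc (x : R[i]) : `|complex.Im x| <= normc x.
Proof.
case: x => x y /=; rewrite -sqrtr_sqr ler_wsqrtr // lerDr; exact: sqr_ge0.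
Qed.

Lemma normc_le_ReIm (x : R[i]) : normc x <= `|complex.Re x| + `|complex.Im x|.
Proof.
case: x => x y /=; rewrite -[leRHS]ger0_norm ?addr_ge0 // -sqrtr_sqr.
rewrite ler_wsqrtr // sqrrD.
by rewrite !real_normK ?num_real // addrAC lerDl mulrn_wge0 // mulr_ge0.
Qed.

Lemma complex_archi (x : C) : exists n : nat, `|x| <= n%:R.
Proof.
exists (Num.bound (normc x)).
rewrite -[`|x|]/((normc x)%:C) -(rmorph_nat (real_complex R)) lecR ltW //.
by rewrite archi_boundP // normc_ge0.
Qed.

(** The norm of [C] has values in [C]; a positive [e] there is real, so that distances can be
    compared in [R]. *)
Lemma complex_cvg_normc (u : nat -> C) (l : C) :
  (fun n => normc (l - u n)) @ \oo --> (0 : R) -> u @ \oo --> l.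
Proof.
move=> h; apply/cvgrPdist_lt => e e0.
have eR : e = (complex.Re e)%:C by rewrite RRe_real // gtr0_real.
have Re0 : 0 < complex.Re e by rewrite -ltcR -eR.
move/cvgrPdist_lt: h => /(_ _ Re0); apply: filterS => n.
by rewrite sub0r normrN ger0_norm ?normc_ge0 // eR ltcR.
Qed.

(** The real and imaginary parts are dominated by a real geometric series, and their sums form the
    limit. *)
Lemma complex_geometric_bound_cvg (u : nat -> C) :
  @geometric_bound C u -> cvgn (series u).
Proof.
move=> [B hB].
have hC k : normc (u k) <= complex.Re B * 8^-1 ^+ k.
  have BR : B = (complex.Re B)%:C.
    by rewrite RRe_real // ger0_real // (geometric_bound_ge0 _ _ _ hB).
  have := hB k; rewrite {1}BR.
  rewrite (_ : 8^-1 ^+ k = (8^-1 ^+ k)%:C) -?rmorphM ?lecR //.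
  by rewrite rmorphXn fmorphV rmorph_nat.
have cv (w : nat -> R) : (forall k, `|w k| <= normc (u k)) -> cvgn (series w).
  move=> hw; apply: normed_cvg.
  apply: (series_le_cvg (v_ := geometric (complex.Re B) 8^-1)) => //=.
  - by move=> k; apply: le_trans (normc_ge0 (u k)) _; exact: hC.
  - by move=> k; apply: le_trans (hw k) (hC k).
  - by apply: is_cvg_geometric_series; rewrite ger0_norm; lra.
have cR := cv _ (fun k => Re_le_normc (u k)).
have cI := cv _ (fun k => Im_le_normc (u k)).
move: cR cI; set a := limn _; set b := limn _ => cR cI.
have ReD (x y : R[i]) : complex.Re (x + y) = complex.Re x + complex.Re y.
  by case: x y => [? ?] [].
have ImD (x y : R[i]) : complex.Im (x + y) = complex.Im x + complex.Im y.
  by case: x y => [? ?] [].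
have sR n : complex.Re (series u n) = series (fun k => complex.Re (u k)) n.
  rewrite /series /=; elim/big_ind2: _ => //.
  by move=> ? ? ? ? <- <-; exact: ReD.
have sI n : complex.Im (series u n) = series (fun k => complex.Im (u k)) n.
  rewrite /series /=; elim/big_ind2: _ => //.
  by move=> ? ? ? ? <- <-; exact: ImD.
have dist (z : R[i]) :
    normc (a +i* b - z) <= `|a - complex.Re z| + `|b - complex.Im z|.
  by rewrite (le_trans (normc_le_ReIm _)) //; case: z.
apply/cvg_ex; exists (a +i* b : C); apply: complex_cvg_normc.
apply: (@squeeze_cvgr _ _ _ _ (fun=> 0)
  (fun n => `|a - series (fun k => complex.Re (u k)) n| +
            `|b - series (fun k => complex.Im (u k)) n|)).
- apply: nearW => n; rewrite normc_ge0 /=.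
  rewrite -sR -sI; exact: dist (series u n).
- exact: cvg_cst.
- rewrite -[X in _ --> X](addr0 (0 : R)); apply: cvgD.
    rewrite -[X in _ --> X](@normr0 _ R); apply: cvg_norm.
    rewrite -(subrr a); apply: cvgB; [exact: cvg_cst|exact: cR].
  rewrite -[X in _ --> X](@normr0 _ R); apply: cvg_norm.
  rewrite -(subrr b); apply: cvgB; [exact: cvg_cst|exact: cI].
Qed.

End Cplx.

Theorem theorem5 (R : realType) (m1 m2 : int) (alpha gamma : R[i]) :
  0 < m1 ^+ 2 + m2 ^+ 2 ->
  well_defined m1 m2 alpha gamma ->
  let N := maxn (absz m1) (absz (m2 - m1)) in
  exists P : {poly R[i]},
    [/\ (size P <= N)%N,
        forall t : R[i], kummer_lhs m1 m2 alpha gamma t = P.[t],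
        P = \poly_(n < N) taylor_coef (kummer_lhs m1 m2 alpha gamma) n &
        forall n : nat, (N <= n)%N ->
          taylor_coef (kummer_lhs m1 m2 alpha gamma) n = 0].
Proof.
move=> _ wd N.
have [P sP hP] := kummer_lhs_poly _ (@complex_archi R)
  (@complex_geometric_bound_cvg R) m1 m2 alpha gamma wd.
(* Equality as functions carries the Taylor coefficients over to the coefficients of [P]. *)
exists P; rewrite (_ : kummer_lhs m1 m2 alpha gamma = horner P); last first.
  by apply/funext => t; exact: hP.
split=> // [|n Nn].
  apply/polyP => n; rewrite coef_poly; case: ltnP => [_|Nn].
    by rewrite taylor_coef_poly.
  by rewrite nth_default // (leq_trans sP).
by rewrite taylor_coef_poly nth_default // (leq_trans sP).
Qed.
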